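(* For any connected simple graph $G=(V,E)$ with $n\geq 2$ nodes and edge connectivity $\lambda$, any value $k$, and any initial distribution of the $k$ messages (i.e. any assignment of the $k$ messages to the nodes initially storing them), any CONGEST algorithm that solves the $k$-broadcast problem with probability at least $1/2$ requires $\Omega(k/\lambda)$ rounds, even if the graph topology and the initial distribution (locations) of the $k$ messages are known to the algorithm.
   Context: CONGEST model: the network is an undirected graph $G=(V,E)$ with $n=|V|$; computation proceeds in synchronous rounds; in each round each node can send one $O(\log n)$-bit message to each of its neighbors; local computation is free. Algorithms may be randomized. $k$-broadcast problem: there are $k$ messages, each an arbitrary string of $\Theta(\log n)$ bits; each message is originally stored in some node of $G$, and a node may initially hold an arbitrary number of messages. The goal is that all nodes of $G$ know all $k$ messages. The contents of the messages are not known in advance to the algorithm (only their initial locations may be known), and the algorithm must succeed with probability at least $1/2$ for every choice of contents. Edge connectivity $\lambda$: the size of a minimum edge cut of $G$. The constant hidden in $\Omega(\cdot)$ is absolute given the constants in the message length and the bandwidth.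
   Formalization: For k = 1 or 2, at least one message is assumed to have two or more bits; otherwise the claim can fail: with n = 2 and a single one-bit message, the other node guesses it with probability 1/2 in zero rounds. *)

(* Defs.v *)
From HB Require Import structures.
From mathcomp Require Import all_boot all_order all_algebra.
From mathcomp Require Import all_classical all_reals all_analysis.

Set Implicit Arguments.
Unset Strict Implicit.
Unset Printing Implicit Defensive.

(* A finite simple graph is a symmetric irreflexive relation [e] on a finite
   type [V]; both properties are hypotheses wherever they are needed. *)

(* Each edge between [S] and its complement is listed once, oriented out
   of [S]. *)
Definition edge_cut (V : finType) (e : rel V) (S : {set V}) : {set V * V} :=
  [set p | [&& p.1 \in S, p.2 \notin S & e p.1 p.2]].

(* The minimum ranges over the nontrivial bipartitions of the vertices.  The
   default #|V| ^ 2 bounds the size of every cut, so it can only be the result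
   when #|V| < 2, where there is no such bipartition. *)
Definition edge_connectivity (V : finType) (e : rel V) : nat :=
  \big[minn/(#|V| ^ 2)%N]_(S : {set V} | (S != finset.set0) && (S != finset.setT))
     #|edge_cut e S|.

(* [contents k] gives the bit string of each of the k messages.  In
   [inputs k], the local input of a node, the entry of a message that is not
   stored at the node is [None]. *)
Notation contents k := {ffun 'I_k -> seq bool}.
Notation inputs k := {ffun 'I_k -> option (seq bool)}.

(* A synchronous message-passing algorithm with at most [b] bits per edge,
   direction and round.  Its vertex arguments are the acting node and, in
   [alg_send], the neighbour addressed.  Sending the empty string stands for
   staying silent.  Local computation is free: states live in any type and
   transitions are any functions.

   The sample point in [Om] holds all the random bits of an execution and is
   given to every node.  This is public randomness; with private randomness
   [Om] is a product over the nodes and a node reads its own component only. *)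
Record congest_alg (V : finType) (k b : nat) (Om : Type) := CongestAlg {
  alg_state : Type;
  alg_init : V -> Om -> inputs k -> alg_state;
  alg_send : V -> alg_state -> V -> b.-bseq bool;
  alg_recv : V -> alg_state -> (V -> b.-bseq bool) -> alg_state;
  alg_output : V -> alg_state -> contents k
}.

Section Execution.
Variables (V : finType) (e : rel V) (k b : nat) (Om : Type).
Variables (loc : 'I_k -> V) (A : congest_alg V k b Om).

Definition local_input (m : contents k) (v : V) : inputs k :=
  [ffun i => if loc i == v then Some (m i) else None].

Definition round (s : V -> alg_state A) : V -> alg_state A :=
  fun v => alg_recv v (s v)
             (fun u => if e u v then alg_send u (s u) v else [bseq]).

Definition run (T : nat) (m : contents k) (w : Om) : V -> alg_state A :=
  iter T round (fun v => alg_init A v w (local_input m v)).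

Definition success (T : nat) (m : contents k) : set Om :=
  [set w | forall v : V, alg_output v (run T m w v) = m]%classic.

End Execution.

(* [len i] is the number of bits of message i. *)
Definition solves_broadcast (R : realType) (V : finType) (e : rel V)
    (k b : nat) (loc : 'I_k -> V) (len : 'I_k -> nat)
    (d : measure_display) (Om : measurableType d) (P : probability Om R)
    (A : congest_alg V k b Om) (T : nat) : Prop :=
  forall m : contents k, (forall i, size (m i) = len i) ->
    measurable (success e loc A T m) /\
    ((2^-1 : R)%:E <= P (success e loc A T m))%E.

(* Main.v *)
(* Fix a minimum cut [S] and the random bits, and let only the messages stored
   on one side of it vary.  A vertex of the other side outputs a function of
   the strings sent across the cut, so at most 3 ^ (b * T * lambda) contents
   succeed.  Averaging over the random bits, half of all the contents must be
   below that bound, so each side stores at most 1 + 2 * b * T * lambda bits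
   of messages. *)

Require Import Defs.
From mathcomp Require Import all_boot all_order all_algebra.
From mathcomp Require Import all_classical all_reals all_analysis.
From mathcomp Require Import measurable_realfun zify lra.
Import Order.TTheory GRing.Theory Num.Theory.
Local Open Scope ring_scope.

Set Implicit Arguments.
Unset Strict Implicit.

(* Unlike 2 ^ b.+1, the bound is exact for b = 0, where nothing can be sent. *)
Lemma card_bseq_bool_le (b : nat) : (#|{: b.-bseq bool}| <= 3 ^ b)%N.
Proof.
(* Padding with [None] up to length [b] leaves three possible entries per position, hence the base
   3. *)
pose f (s : b.-bseq bool) := [ffun i : 'I_b => onth s i].
have f_inj : injective f.
  move=> s t /ffunP est; apply/val_inj/eq_from_onth_le => i.
  move=> /leq_trans/(_ (_ : _ <= b)%N); rewrite geq_max !size_bseq => /(_ isT) ib.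
  by have := est (Ordinal ib); rewrite !ffunE.
by have := leq_card f f_inj; rewrite card_ffun card_option card_bool card_ord.
Qed.

Lemma exists_cut_le_edge_connectivity (V : finType) (e : rel V) : (2 <= #|V|)%N ->
  exists S : {set V}, [/\ S != finset.set0, S != finset.setT &
    (#|edge_cut e S| <= edge_connectivity e)%N].
Proof.
move=> V2; have /card_gt0P[x _] : (0 < #|V|)%N by lia.
have S_nontriv : ([set x]%SET != finset.set0) && ([set x]%SET != finset.setT).
  rewrite -card_gt0 cards1 /=; apply/eqP => /(congr1 (fun S : {set V} => #|S|)).
  by rewrite cards1 cardsT; lia.
move/andP: S_nontriv => [S0 ST]; rewrite /edge_connectivity.
elim/big_ind: _ => [|m n [S1 [? ? S1m]] [S2 [? ? S2n]]|S /andP[? ?]].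
(* The default value [#|V| ^ 2] is at least the size of any set of pairs, so a singleton serves as
   witness. *)
- exists [set x]%SET; split=> //.
  by rewrite (leq_trans (max_card _))// card_prod mulnn.
- by case: (leqP m n) => mn; [exists S1 | exists S2].
- by exists S.
Qed.

Section Cut.
Variables (V : finType) (e : rel V) (k b : nat) (Om : Type).
Variables (loc : 'I_k -> V) (A : congest_alg V k b Om) (S : {set V}).

(** Induction on rounds: what a vertex outside [S] receives comes either from another such vertex,
    whose state agrees by induction, or over a cut edge, where the strings agree by hypothesis. *)
Lemma run_eq_outside_cut (T : nat) (m m' : contents k) (w : Om) :
  (forall i, loc i \notin S -> m i = m' i) ->
  (forall t p, (t < T)%N -> p \in edge_cut e S ->
     alg_send p.1 (run e loc A t m w p.1) p.2 =
     alg_send p.1 (run e loc A t m' w p.1) p.2) ->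
  forall v, v \notin S -> run e loc A T m w v = run e loc A T m' w v.
Proof.
move=> mm'; elim: T => [|T IH] sent v vS.
  rewrite /run /=; congr alg_init; apply/ffunP => i; rewrite !ffunE.
  by case: eqP => // locv; rewrite mm'// locv.
have {}IH : forall u, u \notin S -> run e loc A T m w u = run e loc A T m' w u.
  by apply: IH => t p tT; apply: sent; rewrite ltnS ltnW.
rewrite /run !iterS -!/(run _ _ _ _ _ _) /round IH//.
congr alg_recv; apply/funext => u; case: ifP => // euv.
have [uS|uS] := boolP (u \in S); last by rewrite IH.
by apply: (sent T (u, v)); rewrite // inE /= uS vS euv.
Qed.

(** Only the direction out of [S] is recorded: the strings sent into [S] affect the other side only
    through later replies, which are recorded too. *)
Definition transcript (T : nat) (m : contents k) (w : Om) :
    {ffun 'I_T * {p | p \in edge_cut e S} -> b.-bseq bool} :=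
  [ffun tp : 'I_T * {p | p \in edge_cut e S} =>
     alg_send (val tp.2).1 (run e loc A tp.1 m w (val tp.2).1) (val tp.2).2].

Lemma success_transcript_inj (T : nat) (m m' : contents k) (w : Om) :
  S != finset.setT -> (forall i, loc i \notin S -> m i = m' i) ->
  success e loc A T m w -> success e loc A T m' w ->
  transcript T m w = transcript T m' w -> m = m'.
Proof.
move=> ST mm' sm sm' /ffunP eqt.
have [v vS] : exists v, v \notin S.
  by apply/existsP; rewrite -negb_forall; apply: contra ST => /forallP h;
     apply/eqP/setP => v; rewrite h inE.
rewrite -(sm v) -(sm' v); congr alg_output.
apply: run_eq_outside_cut => // t p tT pS.
by have := eqt (Ordinal tT, exist _ p pS); rewrite !ffunE.
Qed.

Lemma card_transcript_le (T : nat) :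
  (#|{: {ffun 'I_T * {p | p \in edge_cut e S} -> b.-bseq bool}}|
    <= 3 ^ (b * (T * #|edge_cut e S|)))%N.
Proof.
rewrite card_ffun card_prod card_ord card_sig [leqRHS]expnM.
rewrite (eq_card (B := edge_cut e S)) => [|p]; last by rewrite inE.
by case: (T * _)%N => // j; rewrite leq_exp2r// card_bseq_bool_le.
Qed.

End Cut.

(* The number of the events that occur at a sample point is a random variable
   bounded by [N] whose expectation is at least [#|I| / 2]. *)
Lemma half_probability_card_le (R : realType) (d : measure_display)
    (Om : measurableType d) (P : probability Om R) (I : finType)
    (E : I -> set Om) (N : nat) :
  (forall i, measurable (E i)) -> (forall i, ((2^-1 : R)%:E <= P (E i))%E) ->
  (forall w, (#|[set i | `[< E i w >]]%SET| <= N)%N) -> (#|I| <= 2 * N)%N.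
Proof.
move=> mE PE cE.
have mI i : measurable_fun setT (fun w => (\1_(E i) w : R)%:E).
  by apply/measurable_EFinP; exact: measurable_indic.
have I0 i w : (0 <= (\1_(E i) w : R)%:E)%E.
  by rewrite lee_fin.
have lb : ((#|I|%:R / 2)%:E <= \sum_(i <- index_enum I) P (E i))%E.
  have -> : (#|I|%:R / 2)%:E = (\sum_(i <- index_enum I) (2^-1 : R)%:E)%E.
    by rewrite sumEFin sumr_const mulr_natl.
  exact: lee_sum.
have ub : (\sum_(i <- index_enum I) P (E i) <= (N%:R : R)%:E)%E.
  have -> : (\sum_(i <- index_enum I) P (E i) =
      \int[P]_w \sum_(i <- index_enum I) (\1_(E i) w : R)%:E)%E.
    rewrite ge0_integral_sum//; apply: eq_bigr => i _.
    by rewrite integral_indic// setIT.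
  have -> : ((N%:R : R)%:E = \int[P]_(w in setT) (N%:R : R)%:E)%E.
    rewrite integral_cst; last exact: measurableT.
    by rewrite -[LHS]mule1 -(probability_setT P).
  apply: ge0_le_integral => //.
  - by move=> w _; apply: sume_ge0.
  - exact: emeasurable_sum.
  - move=> w _; rewrite sumEFin lee_fin.
    apply: le_trans (_ : (#|[set i | `[< E i w >]]%SET|%:R : R) <= _); last first.
      by rewrite ler_nat.
    rewrite -sum1_card natr_sum [leRHS]big_mkcond /=; apply: ler_sum => i _.
    by rewrite inE indicE -[w \in E i]/`[< E i w >]; case: asbool.
by have := le_trans lb ub; rewrite lee_fin ler_pdivrMr// -natrM ler_nat mulnC.
Qed.

Lemma broadcast_cut_le (R : realType) (V : finType) (e : rel V) (k b : nat)
    (loc : 'I_k -> V) (len : 'I_k -> nat) (d : measure_display)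
    (Om : measurableType d) (P : probability Om R) (A : congest_alg V k b Om)
    (T : nat) (S : {set V}) :
  S != finset.setT -> solves_broadcast e loc len P A T ->
  (\sum_(i | loc i \in S) len i <= 1 + 2 * (b * (T * #|edge_cut e S|)))%N.
Proof.
move=> ST solA.
(* Length 0 outside [S] leaves a single choice there, so [D] counts only the contents stored in
   [S]. *)
pose lenS i := if loc i \in S then len i else 0%N.
have lenSE i : loc i \in S -> lenS i = len i by rewrite /lenS => ->.
pose D := {dffun forall i : 'I_k, (lenS i).-tuple bool}.
have cardD : #|{: D}| = (2 ^ \sum_(i | loc i \in S) len i)%N.
  rewrite card_dep_ffun foldrE big_map big_enum /= expn_sum [RHS]big_mkcond /=.
  by apply: eq_bigr => i _; rewrite card_tuple card_bool /lenS; case: ifP.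
(* Messages outside [S] are frozen to a fixed string of the prescribed length, so every [c x] is an
   admissible input. *)
pose c (x : D) : contents k :=
  [ffun i => if loc i \in S then val (x i) else nseq (len i) false].
have c_inj : injective c.
  move=> x y /ffunP cxy; apply/ffunP => i; apply/val_inj.
  have := cxy i; rewrite !ffunE; case: ifP => // locS _.
  have sz (z : D) : size (val (z i)) = 0%N by rewrite size_tuple /lenS locS.
  by rewrite (size0nil (sz x)) (size0nil (sz y)).
have size_c x i : size (c x i) = len i.
  by rewrite ffunE; case: ifP => locS; rewrite ?size_nseq// size_tuple lenSE.
have solc x := solA (c x) (size_c x).
have : (#|{: D}| <= 2 * 3 ^ (b * (T * #|edge_cut e S|)))%N.
  apply: (half_probability_card_le (P := P) (E := fun x => success e loc A T (c x)))
    => [x|x|w]; [exact: (solc x).1 | exact: (solc x).2 |].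
  apply: leq_trans (card_transcript_le e b S T).
  apply: (@leq_card_in D _ (fun x => transcript e loc A S T (c x) w)) => x y.
  rewrite !inE => sx sy eqt; apply: c_inj.
  apply: success_transcript_inj ST _ sx sy eqt => i /negPf locS.
  by rewrite !ffunE locS.
rewrite cardD => card_le.
rewrite -(@leq_exp2l 2)// (leq_trans card_le)// expnD expn1 leq_mul2l /=.
(* The base 3 is weakened to [2 ^ 2], which gives the factor 2 in the exponent. *)
rewrite [leqRHS]expnM; have [->|n_gt0] := posnP (b * (T * #|edge_cut e S|))%N.
  by rewrite !expn0.
by rewrite leq_exp2r.
Qed.

(** Reversing the edges exchanges the two orientations of a cut, so the same minimum cut also limits
    the flow out of the complement. *)
Lemma card_edge_cutC_le (V : finType) (e : rel V) (S : {set V}) :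
  symmetric e -> (#|edge_cut e (~: S)%SET| <= #|edge_cut e S|)%N.
Proof.
move=> e_sym; pose swap (p : V * V) := (p.2, p.1).
apply: leq_trans (leq_imset_card swap _); apply/subset_leq_card/fintype.subsetP => -[u v].
rewrite !inE /= negbK => /and3P[uS vS euv]; apply/imsetP; exists (v, u) => //.
by rewrite inE /= uS vS e_sym.
Qed.

Theorem theorem3 (R : realType) (a1 a2 beta : R)
    (a1_gt0 : 0 < a1) (a2_gt0 : 0 < a2) (beta_gt0 : 0 < beta) :
  exists2 c : R, 0 < c &
    forall (V : finType) (e : rel V),
      symmetric e -> irreflexive e -> (forall x y : V, connect e x y) ->
      (2 <= #|V|)%N ->
    forall (k : nat) (loc : 'I_k -> V) (len : 'I_k -> nat) (b : nat),
      (forall i : 'I_k,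
         a1 * ln (#|V|%:R : R) <= (len i)%:R <= a2 * ln (#|V|%:R : R)) ->
      (* One or two single-bit messages can be guessed with probability 1/2. *)
      ((0 < k <= 2)%N -> exists i : 'I_k, (2 <= len i)%N) ->
      b%:R <= beta * ln (#|V|%:R : R) ->
    forall (d : measure_display) (Om : measurableType d)
           (P : probability Om R) (A : congest_alg V k b Om) (T : nat),
      solves_broadcast e loc len P A T ->
      c * (k%:R / (edge_connectivity e)%:R) <= T%:R.
Proof.
(* The 8 is the factor in [L_le]; [a1] and [beta] convert message lengths and bandwidth to multiples
   of [ln #|V|], which cancels. *)
exists (a1 / (8 * beta)); first by rewrite divr_gt0// mulr_gt0.
move=> V e e_sym _ _ V2 k loc len b len_bd len2 b_le d Om P A T solA.
have [S [S0 ST cut_le]] := exists_cut_le_edge_connectivity e V2.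
set lam := edge_connectivity e in cut_le *.
have ln_gt0 : 0 < ln (#|V|%:R : R) by rewrite ln_gt0// ltr1n.
have len_gt0 i : (0 < len i)%N.
  by have /andP[+ _] := len_bd i; rewrite -(ltr0n R); apply: lt_le_trans; rewrite mulr_gt0.
pose L := (\sum_i len i)%N; pose n := (b * (T * lam))%N.
have sideS : (\sum_(i | loc i \in S) len i <= 1 + 2 * n)%N.
  apply: leq_trans (broadcast_cut_le ST solA) _.
  by rewrite leq_add2l !leq_mul2l cut_le !orbT.
have sideC : (\sum_(i | loc i \notin S) len i <= 1 + 2 * n)%N.
  have SCT : (~: S)%SET != finset.setT.
    by apply: contra S0 => /eqP SC; rewrite -(finset.setCK S) SC finset.setCT.
  have := broadcast_cut_le SCT solA; rewrite (eq_bigl (fun i => loc i \notin S)); last first.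
    by move=> i; rewrite inE.
  move=> /leq_trans; apply; rewrite leq_add2l !leq_mul2l.
  by rewrite (leq_trans (card_edge_cutC_le _ e_sym) cut_le) !orbT.
have [->|k_gt0] := posnP k; first by rewrite mul0r mulr0.
(* If [n] were 0, each side would store at most one bit. As no message is empty, [k] would be at
   most 2, and [len2] would give a two-bit message on one side. *)
have n_gt0 : (0 < n)%N.
  rewrite lt0n; apply/eqP => n0; rewrite n0 in sideS sideC.
  have k_le : (k <= L)%N.
    by rewrite -[leqLHS]card_ord -sum1_card leq_sum.
  have [|i len_i] := len2.
    rewrite k_gt0 (leq_trans k_le)// /L (bigID (fun i => loc i \in S)) /=.
    exact: leq_add sideS sideC.
  by have [locS|locS] := boolP (loc i \in S);
     [move: sideS | move: sideC]; rewrite (bigD1 i) //=; lia.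
(* The two sides add up to [2 + 4 * n]; positivity of [n] absorbs the additive 2. *)
have L_le : (L <= 8 * n)%N.
  rewrite /L (bigID (fun i => loc i \in S)) /= (leq_trans (leq_add sideS sideC))//.
  lia.
have lam_gt0 : (0 < lam)%N by move: n_gt0; rewrite /n !muln_gt0 => /and3P[].
have kL : k%:R * (a1 * ln (#|V|%:R : R)) <= L%:R.
  rewrite /L natr_sum -[k in leLHS]card_ord mulr_natl -sumr_const.
  by apply: ler_sum => i _; case/andP: (len_bd i).
have key : k%:R * a1 <= 8 * beta * (T%:R * lam%:R).
  rewrite -(ler_pM2r ln_gt0) -[leLHS]mulrA; apply: le_trans kL _.
  have : L%:R <= (8 * n)%:R :> R by rewrite ler_nat.
  move=> /le_trans; apply; rewrite /n !natrM.
  have := ler_wpM2r (ler0n R (T * lam)) b_le; rewrite natrM; lra.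
rewrite mulrACA -invfM ler_pdivrMr; last by rewrite mulr_gt0 ?ltr0n// mulr_gt0.
lra.
Qed.
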